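(* The generating function of the harmonic numbers $H_n$ has the continued fraction expansion $$\sum_{n=0}^\infty H_nx^n=\cfrac{x}{(1-x)-\cfrac{x(1-x)}{2+x-\cfrac{2^{2}x}{3+2x-\cfrac{3^{2}x}{4+3x-\ddots}}}}\,,$$ i.e. the continued fraction $a_0+\cfrac{b_1}{a_1+\cfrac{b_2}{a_2+\ddots}}$ with $a_0=0$, $b_1=x$, $a_1=1-x$, $b_2=-x(1-x)$, $a_n=n+(n-1)x$ for $n\ge 2$, and $b_n=-(n-1)^{2}x$ for $n\ge 3$.
   Context: The harmonic numbers are $H_n=\sum_{k=1}^n\frac{1}{k}$ for $n\ge1$, with $H_0=0$. Convention on continued fractions: for polynomials $a_n$ ($n\ge 0$), $b_n$ ($n\ge 1$) in $x$, the convergents $P_n/Q_n$ of $a_0+\cfrac{b_1}{a_1+\cfrac{b_2}{a_2+\ddots}}$ are defined by $P_{-1}=1$, $Q_{-1}=0$, $P_0=a_0$, $Q_0=1$, $P_n=a_nP_{n-1}+b_nP_{n-2}$, $Q_n=a_nQ_{n-1}+b_nQ_{n-2}$ ($n\ge 1$). A formal power series $f(x)$ has this continued fraction expansion (written as an equality) if for every $n\ge 0$ the power series expansion at $x=0$ of $P_n(x)/Q_n(x)$ agrees with $f(x)$ up to and including the term in $x^n$, i.e. $P_n/Q_n\equiv f\pmod{x^{n+1}}$; in particular $f=\lim_{n\to\infty}P_n/Q_n$ as formal power series. *)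

(* Defs.v *)
From mathcomp Require Import all_boot all_order all_algebra.

Set Implicit Arguments.
Unset Strict Implicit.
Unset Printing Implicit Defensive.

Import GRing.Theory.
Local Open Scope ring_scope.

(* The formal power series \sum_n (f n) x^n is represented by its sequence of
   coefficients. *)
Definition fps (F : fieldType) := nat -> F.

Definition fps_of_poly (F : fieldType) (p : {poly F}) : fps F := fun n => p`_n.

Definition fps_mul (F : fieldType) (f g : fps F) : fps F :=
  fun n => \sum_(i < n.+1) f i * g (n - i)%N.

(* g is the power series expansion at 0 of the rational function p / q.
   As F[[x]] is an integral domain, there is at most one such g. *)
Definition ratfun_expansion (F : fieldType) (p q : {poly F}) (g : fps F) : Prop :=
  q != 0 /\ forall n, fps_mul (fps_of_poly q) g n = (fps_of_poly p) n.

(* f = g modulo x^m *)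
Definition fps_eqmod (F : fieldType) (m : nat) (f g : fps F) : Prop :=
  forall k, (k < m)%N -> f k = g k.

(* The pair (u_(n-1), u_n), where u_(-1) = u, u_0 = v and
   u_n = a_n u_(n-1) + b_n u_(n-2) for n >= 1; the value b 0 is not used. *)
Fixpoint cf_rec (F : fieldType) (a b : nat -> {poly F}) (u v : {poly F}) (n : nat)
    : {poly F} * {poly F} :=
  if n is m.+1 then
    let: (y, z) := cf_rec a b u v m in (z, a n * z + b n * y)
  else (u, v).

Definition cf_num (F : fieldType) (a b : nat -> {poly F}) (n : nat) : {poly F} :=
  (cf_rec a b 1 (a 0%N) n).2.

Definition cf_den (F : fieldType) (a b : nat -> {poly F}) (n : nat) : {poly F} :=
  (cf_rec a b 0 1 n).2.

Definition has_cf_expansion (F : fieldType) (f : fps F) (a b : nat -> {poly F}) : Prop :=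
  forall n, exists g : fps F,
    ratfun_expansion (cf_num a b n) (cf_den a b n) g /\ fps_eqmod n.+1 g f.

Definition harmonic_number (n : nat) : rat := \sum_(1 <= k < n.+1) k%:R^-1.

Definition harmonic_cf_a (n : nat) : {poly rat} :=
  match n with
  | 0 => 0
  | 1 => 1 - 'X
  | _ => n%:R + (n - 1)%N%:R * 'X
  end.

(* The value at 0 is a dummy. *)
Definition harmonic_cf_b (n : nat) : {poly rat} :=
  match n with
  | 0 => 0
  | 1 => 'X
  | 2 => - ('X * (1 - 'X))
  | _ => - (((n - 1) ^ 2)%N%:R * 'X)
  end.

(* Main.v *)
(* With [S_n] the sum of [x^k / k] over [1 <= k <= n], the convergents satisfy
   [P_n = n! S_n] and, for [n >= 1], [Q_n = n! (1 - x)].  Hence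
   [P_n / Q_n = S_n / (1 - x)], whose coefficient of [x^k] is [H_(min k n)]. *)
Require Import Defs.
From mathcomp Require Import all_boot all_order all_algebra.
From mathcomp Require Import ring.

Set Implicit Arguments.
Unset Strict Implicit.
Unset Printing Implicit Defensive.

Import Order.TTheory GRing.Theory Num.Theory.
Local Open Scope ring_scope.

(* The constant coefficient is [0] since [0^-1 = 0]. *)
Definition log_poly (n : nat) : {poly rat} := \poly_(k < n.+1) k%:R^-1.

Lemma log_poly0 : log_poly 0 = 0.
Proof. by rewrite /log_poly poly_def big_ord1 invr0 scale0r. Qed.

Lemma log_polyS n : log_poly n.+1 = log_poly n + n.+1%:R^-1 *: 'X^(n.+1).
Proof. by rewrite /log_poly !poly_def big_ord_recr. Qed.

(** Clearing the denominator leaves an identity with natural coefficients, so [ring] can close the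
    recurrence for the numerators. *)
Lemma natr_mul_log_polyS n :
  n.+1%:R * log_poly n.+1 = n.+1%:R * log_poly n + 'X^(n.+1).
Proof.
rewrite log_polyS mulrDr [X in _ + X]mulr_natl
  -(scaler_nat _ (_ *: _)) scalerA divff.
  by rewrite scale1r.
by rewrite pnatr_eq0.
Qed.

Lemma harmonic_numberS n :
  harmonic_number n.+1 = harmonic_number n + n.+1%:R^-1.
Proof. by rewrite /harmonic_number big_nat_recr. Qed.

(** Multiplication by [1 - 'X] takes differences of consecutive coefficients; [c] will be the
    factorial in the denominators. *)
Lemma fps_mul_natr_sub1X (F : fieldType) (c : nat) (g : fps F) n :
  fps_mul (fps_of_poly (c%:R * (1 - 'X))) g n =
  c%:R * (if n is m.+1 then g m.+1 - g m else g 0%N).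
Proof.
have coefq k : (c%:R * (1 - 'X) : {poly F})`_k =
    c%:R * ((k == 0)%N%:R - (k == 1)%N%:R).
  by rewrite mulr_natl coefMn coefB coef1 coefX mulr_natl.
rewrite /fps_mul /fps_of_poly; case: n => [|n].
  by rewrite big_ord1 coefq /= subr0 mulr1.
rewrite !big_ord_recl big1 => [|i _]; rewrite !coefq /=.
  by rewrite /bump /= add1n subn0 subSS subn0; ring.
by rewrite subrr mulr0 mul0r.
Qed.

Lemma harmonic_cf_num n :
  cf_rec harmonic_cf_a harmonic_cf_b 1 0 n.+1 =
  (n`!%:R * log_poly n, n.+1`!%:R * log_poly n.+1).
Proof.
elim: n => [|n IHn].
  rewrite /= log_poly0 fact0 natr_mul_log_polyS log_poly0.
  by rewrite !mulr0 !add0r expr1 mulr1.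
rewrite [LHS]/= -/(cf_rec _ _ _ _ n.+1) IHn; congr pair.
(* The exceptional [b_2] may be replaced by the generic formula here, since it multiplies
   [P_0 = 0]. *)
have b_n : harmonic_cf_b n.+2 * (n`!%:R * log_poly n) =
    - (n.+1%:R ^+ 2 * 'X * (n`!%:R * log_poly n)).
  case: n {IHn} => [|n]; first by rewrite log_poly0 !mulr0 oppr0.
  by rewrite /= subn1 natrX mulNr.
rewrite b_n subn1 /= [n.+2`!]factS [n.+1`!]factS !natrM.
have:= natr_mul_log_polyS n; have:= natr_mul_log_polyS n.+1.
set L2 := log_poly n.+2; set L1 := log_poly n.+1; set L0 := log_poly n.
rewrite [_ * _ * L2]mulrAC => -> E.
(* Writing the new top power through [L1] and [L0] produces the ['X] terms of the recurrence. *)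
have -> : 'X^(n.+2) = 'X * (n.+1%:R * L1 - n.+1%:R * L0) :> {poly rat}.
  by rewrite E addrC addKr -exprS.
by ring.
Qed.

(** The exceptional [b_2] makes [1 - 'X] a factor of [Q_2]; afterwards the ['X] parts of [a_n] and
    [b_n] cancel, leaving [Q_n = n * Q_(n-1)]. The index starts at [n.+2] because [Q_0 = 1] lacks
    this factor. *)
Lemma harmonic_cf_den n :
  cf_rec harmonic_cf_a harmonic_cf_b 0 1 n.+2 =
  (n.+1`!%:R * (1 - 'X), n.+2`!%:R * (1 - 'X)).
Proof.
elim: n => [|n IHn].
  by rewrite /= !factS fact0 !muln1 subn1 /=; congr pair; ring.
rewrite [LHS]/= -/(cf_rec _ _ _ _ n.+2) IHn; congr pair.
rewrite !subn1 /= natrX [n.+3`!]factS [n.+2`!]factS !natrM.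
by ring.
Qed.

Theorem corollary8 :
  has_cf_expansion (harmonic_number : fps rat) harmonic_cf_a harmonic_cf_b.
Proof.
move=> n; exists (fun k => harmonic_number (minn k n)).
split; last by move=> k; rewrite ltnS => /minn_idPl ->.
have H0 : harmonic_number 0 = 0 by rewrite /harmonic_number big_geq.
case: n => [|n].
  split; first exact: oner_neq0.
  move=> k; rewrite /fps_of_poly /cf_num /= coef0.
  by apply: big1 => i _; rewrite minn0 H0 mulr0.
have numE : cf_num harmonic_cf_a harmonic_cf_b n.+1 =
  n.+1`!%:R * log_poly n.+1 by rewrite /cf_num harmonic_cf_num.
have denE : cf_den harmonic_cf_a harmonic_cf_b n.+1 = n.+1`!%:R * (1 - 'X).
  case: n {numE} => [|n]; last by rewrite /cf_den harmonic_cf_den.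
  by rewrite /cf_den /= mulr1 mulr0 addr0 mul1r.
rewrite numE denE; split.
  rewrite mulf_neq0 //; last by rewrite -opprB oppr_eq0 -polyC1 polyXsubC_eq0.
  by rewrite -polyC_natr polyC_eq0 pnatr_eq0 -lt0n fact_gt0.
move=> k; rewrite fps_mul_natr_sub1X /fps_of_poly !mulr_natl coefMn.
congr (_ *+ _); rewrite coef_poly.
case: k => [|k]; first by rewrite min0n H0 invr0.
(* Up to the truncation degree the difference of harmonic numbers is [k.+1%:R^-1]; beyond it both
   minima equal [n.+1] and the difference vanishes. *)
rewrite !ltnS; case: (leqP k n) => [le_kn | lt_nk].
  rewrite (minn_idPl _) // (minn_idPl _) ?(leqW le_kn) //.
  by rewrite harmonic_numberS addrC addKr.
by rewrite (minn_idPr _) ?(minn_idPr _) ?subrr // leqW.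
Qed.
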